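(* Let $X$ be some domain, $Y=\{0,1\}$, $\mathcal{H}\subseteq\mathcal{F}$ a hypothesis class with finite VC-dimension and let $\mathcal{U}:X\to 2^X$ be a perturbation type such that the margin class $\mathcal{H}^{\mathcal{U}}_{\mathrm{mar}}$ also has finite VC-dimension. If a learner is given additional access to an unlabeled i.i.d. sample $T$ from $P_X$, then $\mathcal{H}$ is properly learnable with respect to the robust loss $\ell^{\mathcal{U}}$ and the class of distributions $P$ over $X\times Y$ that are robust-realizable by $\mathcal{H}$, i.e. $\mathcal{L}^{\mathcal{U}}_P(\mathcal{H})=0$ in the sense that there exists $h^*\in\mathcal{H}$ with $\mathcal{L}^{\mathcal{U}}_P(h^* )=0$, with labeled sample complexity $\tilde{O}\left(\frac{\mathrm{VC}(\mathcal{H})+\log(1/\delta)}{\epsilon}\right)$ and unlabeled sample complexity $\tilde{O}\left(\frac{\mathrm{VC}(\mathcal{H}^{\mathcal{U}}_{\mathrm{mar}})+\log(1/\delta)}{\epsilon}\right)$.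
   Context: $\mathcal{F}$ is the set of all Borel-measurable functions $X\to Y$ (all functions if $X$ is countable). A perturbation type is a map $\mathcal{U}:X\to 2^X$ with $x\in\mathcal{U}(x)$ for all $x\in X$. The robust loss is $\ell^{\mathcal{U}}(h,x,y)=\mathbf{1}[\exists z\in\mathcal{U}(x): h(z)\neq y]$, assumed measurable in $(x,y)$ for every $h\in\mathcal{F}$; $\mathcal{L}^{\mathcal{U}}_P(h)=\mathbb{E}_{(x,y)\sim P}[\ell^{\mathcal{U}}(h,x,y)]$ and $\mathcal{L}^{\mathcal{U}}_P(\mathcal{H})=\inf_{h\in\mathcal{H}}\mathcal{L}^{\mathcal{U}}_P(h)$. $P_X$ is the marginal of $P$ on $X$. The margin area of $h$ is $\mathrm{mar}^{\mathcal{U}}_h=\{(x,y)\in X\times Y:\exists z\in\mathcal{U}(x),\ h(x)\neq h(z)\}$ (which may be identified with its projection to $X$); the margin class is $\mathcal{H}^{\mathcal{U}}_{\mathrm{mar}}=\{\mathrm{mar}^{\mathcal{U}}_h: h\in\mathcal{H}\}$. VC-dimension of a collection of sets is the supremum of sizes of shattered sets; $h$ is identified with $\{x:h(x)=1\}$. Properly learnable with labeled sample complexity $m(\epsilon,\delta)$ and unlabeled sample complexity $n(\epsilon,\delta)$ means: there is a learner taking a labeled sample $S$ and an unlabeled sample $T$, always outputting an element of $\mathcal{H}$, such that for all $\epsilon,\delta\in(0,1)$ and every $P$ in the stated class, if $S$ is i.i.d. from $P$ with $|S|\ge m(\epsilon,\delta)$ and $T$ is i.i.d. from $P_X$ with $|T|\ge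 n(\epsilon,\delta)$, then with probability at least $1-\delta$ the output $h$ satisfies $\mathcal{L}^{\mathcal{U}}_P(h)\le\mathcal{L}^{\mathcal{U}}_P(\mathcal{H})+\epsilon$. $\tilde{O}$ hides logarithmic factors.
   Formalization: H is assumed nonempty, and H and its margin class are assumed to satisfy the usual measurability proviso of VC theory (sample events ''some member realizes a given pattern'' are measurable up to null sets); without it the claim fails on some uncountable domains. *)

(* Defs.v *)
(* MathComp / MathComp-Analysis *)
From HB Require Import structures.
From mathcomp Require Import all_boot all_order all_algebra.
From mathcomp Require Import all_classical all_reals all_analysis.

Set Implicit Arguments.
Unset Strict Implicit.
Unset Printing Implicit Defensive.

Import Order.TTheory GRing.Theory Num.Theory.
Import numFieldNormedType.Exports.

Local Open Scope classical_set_scope.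
Local Open Scope ring_scope.

Section vc_dimension.
Context {T : Type}.

Definition shatters (C : set (set T)) (A : set T) : Prop :=
  forall B, B `<=` A -> exists2 c, C c & A `&` c = B.

(* As a supremum in the extended reals: +oo when arbitrarily large finite sets
   are shattered, -oo for the empty collection. *)
Definition vc_dim (R : realType) (C : set (set T)) : \bar R :=
  ereal_sup [set (n%:R)%:E | n in
    [set n : nat | exists2 A : set T, (A #= `I_n)%card & shatters C A]].

End vc_dimension.

Section iid.
Context {d} {T : measurableType d} {R : realType}.

Definition tcons n (z : T * n.-tuple T) : n.+1.-tuple T :=
  [tuple of z.1 :: z.2].

Lemma measurable_tcons n : measurable_fun [set: T * n.-tuple T] (@tcons n).
Proof. exact: (measurable_cons measurable_fst measurable_snd). Qed.

HB.instance Definition _ n :=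
  isMeasurableFun.Build _ _ _ _ (@tcons n) (@measurable_tcons n).

(* The law of an i.i.d. sample of size n, i.e. the n-fold product of P. *)
Fixpoint iid_law (P : probability T R) (n : nat) : probability (n.-tuple T) R :=
  match n with
  | 0 => \d_([tuple] : 0.-tuple T)
  | n'.+1 => distribution (P \x iid_law P n')%E (@tcons n')
  end.

Lemma iid_law_box (P : probability T R) n (A : 'I_n -> set T) :
  (forall i, measurable (A i)) ->
  (iid_law P n [set x | forall i, A i (tnth x i)] = \prod_(i < n) P (A i))%E.
Proof.
elim: n A => [|n IHn] A mA.
  rewrite big_ord0 /= diracE mem_set//.
  by case.
rewrite big_ord_recl -IHn => [|i]; last exact: mA.
have mbox : measurable
    [set x : n.-tuple T | forall i, A (lift ord0 i) (tnth x i)].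
  rewrite (_ : [set x | _] =
    \bigcap_(i in [set: 'I_n]) ((@tnth n T ^~ i) @^-1` A (lift ord0 i))).
    apply: fin_bigcap_measurable => // i _.
    by rewrite -[X in measurable X]setTI; exact: measurable_tnth.
  by apply/seteqP; split => x /= h i; [move=> _|]; exact: h.
rewrite -product_measure1E//=; congr (_ _).
apply/seteqP; split => [[x s]|[x s] [/= Ax As] i] /=.
  move=> h; split => /=; first exact: (h ord0).
  by move=> i; have := h (lift ord0 i); rewrite /tcons tnthS.
have [->|i0] := eqVneq i ord0; first by [].
by case: (unliftP ord0 i) i0 => [j -> _|-> /eqP//]; rewrite /tcons tnthS; exact: As.
Qed.

(* Inner probability: the event itself need not be measurable. *)
Definition with_probability_ge {d'} {W : measurableType d'}
    (mu : probability W R) (r : R) (event : set W) : Prop :=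
  exists E, [/\ measurable E, E `<=` event & (r%:E <= mu E)%E].

(* The samples on which some member of C cuts out the pattern b. *)
Definition trace_event (C : set (set T)) n (b : n.-tuple bool) :
    set (n.-tuple T) :=
  [set x | exists2 c, C c & forall i, c (tnth x i) <-> tnth b i].

End iid.

(* The usual measurability convention of VC theory: up to null sets of the product
   law, suprema over C of empirical counts are measurable. It holds when C is a
   countable family of measurable sets, or when T is countable and discrete.
   Without it, finite VC-dimension does not imply learnability on an arbitrary
   measurable space. *)
Definition sample_measurable (R : realType) d (T : measurableType d)
    (C : set (set T)) : Prop :=
  forall (Q : probability T R) n (b : n.-tuple bool),
    exists2 A, measurable A &
      (iid_law Q n).-negligible (A `+` trace_event C b).

Section robust_learning.
Context {R : realType} {d} {X : measurableType d}.

HB.instance Definition _ :=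
  isMeasurableFun.Build _ _ _ _ (@fst X bool) measurable_fst.

(* Labels 0 and 1 are the booleans. *)
Definition hypothesis_sets (H : set (X -> bool)) : set (set X) :=
  [set [set x | h x] | h in H].

(* The margin area, as a subset of X: membership does not depend on the label. *)
Definition margin (U : X -> set X) (h : X -> bool) : set X :=
  [set x | exists2 z, U x z & h x <> h z].

Definition margin_class (U : X -> set X) (H : set (X -> bool)) : set (set X) :=
  [set margin U h | h in H].

Definition robust_loss (U : X -> set X) (h : X -> bool) (p : X * bool) : R :=
  \1_[set q : X * bool | exists2 z, U q.1 z & h z <> q.2] p.

Definition robust_risk (U : X -> set X) (P : probability (X * bool)%type R)
    (h : X -> bool) : \bar R :=
  'E_P[robust_loss U h].

Definition best_robust_risk (U : X -> set X)
    (P : probability (X * bool)%type R) (H : set (X -> bool)) : \bar R :=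
  ereal_inf [set robust_risk U P h | h in H].

Definition robust_realizable (U : X -> set X) (H : set (X -> bool))
    (P : probability (X * bool)%type R) : Prop :=
  exists2 h, H h & robust_risk U P h = 0%E.

Definition marginal (P : probability (X * bool)%type R) : probability X R :=
  distribution P (@fst X bool).

(* The labeled and the unlabeled sample are independent of each other. *)
Definition properly_learnable (U : X -> set X) (H : set (X -> bool))
    (D : probability (X * bool)%type R -> Prop) (m n : R -> R -> nat) : Prop :=
  exists2 learner : seq (X * bool) -> seq X -> X -> bool,
    (forall S T, H (learner S T)) &
    forall eps delta : R, 0 < eps < 1 -> 0 < delta < 1 ->
    forall P, D P ->
    forall p q, (m eps delta <= p)%N -> (n eps delta <= q)%N ->
    with_probability_ge (iid_law P p \x iid_law (marginal P) q)%E (1 - delta)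
      [set ST : p.-tuple (X * bool) * q.-tuple X |
        (robust_risk U P (learner ST.1 ST.2)
           <= best_robust_risk U P H + eps%:E)%E].

End robust_learning.

(* soft_O C k g is the bound C g log^k (g + 2): f is soft-O of g when f is at
   most soft_O C k g for some constants C and k. The shift by 2 keeps the
   logarithm away from 0. *)
Definition soft_O (R : realType) (C : R) (k : nat) (g : R) : R :=
  C * g * ln (g + 2) ^+ k.

(* Main.v *)
Require Import Defs.
From HB Require Import structures.
From mathcomp Require Import all_boot all_order all_algebra.
From mathcomp Require Import all_classical all_reals all_analysis.
From mathcomp Require Import measurable_realfun ring lra.

(** The learner returns any h in H that is correct on the labeled sample and
whose margin area contains no point of the unlabeled sample. Since
robust_loss h (x, y) <= 1[h x <> y] + 1[x in margin h], it suffices that each of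
these two terms has small expectation. Both are instances of one fact about a VC
class C with target c0: with high probability, every c in C with the same trace
as c0 on the sample satisfies P (c `+` c0) <= eps / 2. For the labels c0 is the
robust classifier h*, for the margin class it is the null set margin h*.

That fact is proved by double sampling. If c is far from c0, a second sample of
the same size m, cut into k blocks each long enough to hit c `+` c0 with
probability at least 1 - 1/(2k), exhibits k disagreements with probability at
least 1/2. By exchangeability under swaps of the i-th points of the two samples,
a fixed trace shows k disagreements all in the second sample with probability at
most 2^-k, and by Sauer-Shelah there are at most (2m+1)^v traces. Taking
k ~ v log and m ~ k log / eps only costs logarithmic factors. *)

Set Implicit Arguments.
Unset Strict Implicit.
Unset Printing Implicit Defensive.

Import Order.TTheory GRing.Theory Num.Theory.
Import numFieldNormedType.Exports.

Local Open Scope classical_set_scope.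
Local Open Scope ring_scope.

(** * Combinatorics of binary patterns: the Sauer-Shelah bound and swaps of two halves *)

Section traces.
Local Open Scope nat_scope.
Local Open Scope set_scope.

Definition pattern_shatters n (W : {set n.-tuple bool}) (I : {set 'I_n}) :=
  forall f : 'I_n -> bool,
    exists2 t, t \in W & forall i, i \in I -> tnth t i = f i.

(** A tail that extends by both bits is counted twice: once in the union and once in the
    intersection. *)
Lemma card_tuple_behead n (W : {set n.+1.-tuple bool}) :
  let D b := [set t : n.-tuple bool | [tuple of b :: t] \in W] in
  #|W| = #|D false :|: D true| + #|D false :&: D true|.
Proof.
move=> D; rewrite cardsUI.
have injc b : injective (fun t : n.-tuple bool => [tuple of b :: t]).
  by move=> s t /(congr1 val) [] st; apply/val_inj.
have eqD b : #|D b| = #|[set t in W | thead t == b]|.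
  rewrite -(card_imset _ (injc b)); apply: eq_card => t; rewrite inE.
  apply/imsetP/andP => [[s + ->]|[tW /eqP tb]]; first by rewrite inE.
  case/tupleP: t tb tW => c t; rewrite theadE => -> tW.
  by exists t => //; rewrite inE.
rewrite !eqD addnC.
have -> : [set t in W | thead t == true] = W :&: [set t | thead t].
  by apply/setP => t; rewrite !inE eqb_id.
have -> : [set t in W | thead t == false] = W :\: [set t | thead t].
  by apply/setP => t; rewrite !inE eqbF_neg andbC.
by rewrite cardsID.
Qed.

(** Induction on the length, splitting off the first bit. The union of the two sets of tails
    shatters nothing new. If their intersection shatters [I], both first bits remain free, so [W]
    shatters [I] shifted together with index 0; this lowers [v] by one. *)
Lemma sauer_shelah n v (W : {set n.-tuple bool}) :
  (forall I, pattern_shatters W I -> #|I| <= v) -> #|W| <= n.+1 ^ v.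
Proof.
elim: n v W => [|n IHn] v W Wv.
  by rewrite exp1n -[1]/(2 ^ 0) -card_bool -card_tuple max_card.
have injl : injective (lift (@ord0 n)) by exact: lift_inj.
rewrite card_tuple_behead /=.
pose D b := [set t : n.-tuple bool | [tuple of b :: t] \in W].
rewrite -/(D false) -/(D true).
have DU I : pattern_shatters (D false :|: D true) I -> #|I| <= v.
  move=> sI; rewrite -(card_imset _ injl); apply: Wv => f.
  have [t tD tf] := sI (fun i => f (lift ord0 i)).
  have [b tb] : exists b, [tuple of b :: t] \in W.
    by move: tD; rewrite !inE => /orP[]; eexists; eassumption.
  by exists [tuple of b :: t] => // i /imsetP[j jI ->]; rewrite tnthS tf.
have DI I : pattern_shatters (D false :&: D true) I -> #|I| < v.
  move=> sI; have -> : #|I|.+1 = #|ord0 |: (lift (@ord0 n) @: I)|.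
    rewrite cardsU1 card_imset// (_ : ord0 \notin _)//.
    by apply/imsetP => -[j _ /eqP]; rewrite (negPf (neq_lift _ _)).
  apply: Wv => f; have [t tD tf] := sI (fun i => f (lift ord0 i)).
  exists [tuple of f ord0 :: t].
    by move: tD; rewrite !inE => /andP[]; case: (f ord0).
  by move=> i /setU1P[->|/imsetP[j jI ->]]; rewrite ?tnth0// tnthS tf.
case: v Wv DU DI => [|v] Wv DU DI.
  (* For [v = 0] the intersection is empty, since any element would make it shatter the empty
     set. *)
  rewrite (_ : D false :&: D true = finset.set0) ?cards0 ?addn0.
    by apply: leq_trans (IHn _ _ DU) _; rewrite !expn0.
  apply/setP => t; rewrite [RHS]inE; apply/negP => tD.
  suff : #|@finset.set0 'I_n| < 0 by [].
  by apply: DI => f; exists t => // i; rewrite inE.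
have {}DI I : pattern_shatters (D false :&: D true) I -> #|I| <= v.
  exact: DI.
apply: (@leq_trans (n.+1 ^ v.+1 + n.+1 ^ v)).
  by rewrite leq_add ?IHn.
(* The sum is (n+2)(n+1)^v, at most (n+2)^(v+1). *)
rewrite expnS -mulSnr expnS leq_mul2l /=; case: v {Wv DU DI} => // v.
by rewrite leq_exp2r// leqnSn.
Qed.

Definition swap_halves m (s : {set 'I_m}) (j : 'I_(m + m)) : 'I_(m + m) :=
  match fintype.split j with
  | inl i => if i \in s then rshift m i else lshift m i
  | inr i => if i \in s then lshift m i else rshift m i
  end.

Lemma swap_halvesL m (s : {set 'I_m}) i :
  swap_halves s (lshift m i) = if i \in s then rshift m i else lshift m i.
Proof. by rewrite /swap_halves (unsplitK (inl i)). Qed.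

Lemma swap_halvesR m (s : {set 'I_m}) i :
  swap_halves s (rshift m i) = if i \in s then lshift m i else rshift m i.
Proof. by rewrite /swap_halves (unsplitK (inr i)). Qed.

Lemma swap_halves_inj m (s : {set 'I_m}) : injective (swap_halves s).
Proof.
apply: (can_inj (g := swap_halves s)) => j.
case: (split_ordP j) => i ->; rewrite ?(swap_halvesL, swap_halvesR);
  by case: ifP => i_s; rewrite ?(swap_halvesL, swap_halvesR) i_s.
Qed.

Definition late_errors m k (e : 'I_(m + m) -> bool) :=
  [forall i, ~~ e (lshift m i)] && (k <= #|[pred i | e (rshift m i)]|).

(** Fix one good swap [s0]. At each index of [I], exactly one of the paired points is an error, and
    every good swap must send it to the second half, so it agrees with [s0] there. A good swap is
    thus determined outside [I], which has at least [k] elements. *)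
Lemma card_swaps_late_errors m k (e : 'I_(m + m) -> bool) :
  #|[set s | late_errors k (e \o swap_halves s)]| * 2 ^ k <= 2 ^ m.
Proof.
set G := [set s | _].
have [->|[s0 s0G]] := set_0Vmem G; first by rewrite cards0.
pose I := [set i | e (swap_halves s0 (rshift m i))].
have kI : k <= #|I| by move: s0G; rewrite inE cardsE => /andP[].
have GI s i : s \in G -> i \in I -> (i \in s) = (i \in s0).
  rewrite !inE => /andP[/forallP/(_ i)/= + _].
  rewrite swap_halvesL swap_halvesR.
  by do 2 case: ifP => // _; move=> /negPf->.
have injG : {in G &, injective (fun s => s :\: I)}.
  move=> s t sG tG /setP st; apply/setP => i.
  have [iI|iI] := boolP (i \in I); first by rewrite (GI s)// (GI t).
  by have := st i; rewrite !finset.in_setD iI.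
rewrite -(card_in_imset injG).
apply: (@leq_trans (2 ^ #|~: I| * 2 ^ #|I|)).
  apply: leq_mul; last by rewrite leq_exp2l.
  rewrite -card_powerset subset_leq_card//.
  apply/fintype.subsetP => _ /imsetP[s _ ->].
  by rewrite powersetE; apply/fintype.subsetP => i; rewrite !inE => /andP[].
by rewrite -expnD addnC cardsC card_ord.
Qed.

End traces.

(** * Laws of i.i.d. samples: uniqueness, reindexing, concatenation *)

Section iid_law_theory.
Context {d} {T : measurableType d} {R : realType}.
Implicit Types (P : probability T R).

Definition box n (A : 'I_n -> set T) : set (n.-tuple T) :=
  [set x | forall i, A i (tnth x i)].

Lemma measurable_box n (A : 'I_n -> set T) :
  (forall i, measurable (A i)) -> measurable (box A).
Proof.
move=> mA; rewrite (_ : box A =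
    \bigcap_(i in [set: 'I_n]) ((@tnth n T ^~ i) @^-1` A i)).
  apply: fin_bigcap_measurable => // i _.
  by rewrite -[X in measurable X]setTI; exact: measurable_tnth.
by apply/seteqP; split => x /= h i; [move=> _|]; exact: h.
Qed.

(** Boxes form a pi-system that generates the product sigma-algebra. *)
Lemma iid_law_unique n P (mu : {measure set (n.-tuple T) -> \bar R}) :
  (forall A : 'I_n -> set T, (forall i, measurable (A i)) ->
    mu (box A) = \prod_(i < n) P (A i))%E ->
  forall E, measurable E -> mu E = iid_law P n E.
Proof.
move=> muE; pose G := [set box A | A in [set A : 'I_n -> set T |
  forall i, measurable (A i)]].
have GT : G setT.
  by exists (fun=> setT) => //; apply/seteqP; split.
apply: (measure_unique G (fun=> setT)) => //.
- apply/seteqP; split; last first.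
    apply: smallest_sub; first exact: sigma_algebra_measurable.
    by move=> _ [A mA <-]; exact: measurable_box.
  apply: smallest_sub; first exact: smallest_sigma_algebra.
  apply: (big_ind (fun S => S `<=` <<s G >>)) => // [S S'|i _ _ [A mA <-]].
    by rewrite subUset.
  apply: sub_sigma_algebra.
  exists (fun j => if j == i then A else setT) => [j|].
    by case: ifP.
  apply/seteqP; split => x /=.
    by move=> /(_ i); rewrite eqxx.
  by move=> [_ Ax] j; case: eqP => // ->.
- move=> _ _ [A mA <-] [B mB <-]; exists (fun i => A i `&` B i) => [i|].
    exact: measurableI.
  apply/seteqP; split => x /=.
    by move=> AB; split=> i; case: (AB i).
  by move=> [Ax Bx] i; split.
- by rewrite bigcup_const//; exists 0%N.
- by move=> _ [A mA <-]; rewrite muE// -iid_law_box.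
- move=> _; rewrite (_ : setT = box (fun=> setT)); last first.
    by apply/seteqP; split.
  by rewrite muE// big1 ?ltry// => i _; rewrite probability_setT.
Qed.

End iid_law_theory.

Section reindex.
Context {d d'} {T : measurableType d} {T' : measurableType d'} {R : realType}.

Definition reindex m n (h : 'I_m -> 'I_n) (f : T -> T') (x : n.-tuple T) :
  m.-tuple T' := [tuple f (tnth x (h i)) | i < m].

Lemma measurable_reindex m n (h : 'I_m -> 'I_n) (f : T -> T') :
  measurable_fun [set: T] f -> measurable_fun setT (reindex h f).
Proof.
move=> mf; apply/measurable_fun_tnthP => i.
rewrite (_ : _ \o _ = f \o (@tnth n T ^~ (h i))).
  by apply: measurableT_comp => //; exact: measurable_tnth.
by apply/funext => x /=; rewrite tnth_mktuple.
Qed.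

(* For f = id, this is exchangeability when h is a permutation, and passing to a
   subsample when h is an inclusion. *)
Lemma iid_law_reindex m n (h : 'I_m -> 'I_n) (f : T -> T')
    (P : probability T R) (Q : probability T' R) (E : set (m.-tuple T')) :
  injective h -> measurable_fun [set: T] f ->
  (forall A, measurable A -> Q A = P (f @^-1` A)) ->
  measurable E -> iid_law P n (reindex h f @^-1` E) = iid_law Q m E.
Proof.
move=> injh mf QE mE.
pose F : {mfun n.-tuple T >-> m.-tuple T'} :=
  mfun_Sub (mem_set (measurable_reindex h mf)).
rewrite -(@iid_law_unique _ _ _ _ _ (distribution (iid_law P n) F))// => A mA.
(* By injectivity of [h] at most one [i] contributes to [B j]; off the range of [h] the empty
   intersection is the full set. *)
pose B j := \bigcap_(i in [set i | h i = j]) (f @^-1` A i).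
have BhE i : B (h i) = f @^-1` A i.
  by apply/seteqP; split => [x|x Ax k /injh ->//]; exact.
have BT j : j \notin (h @: [set: 'I_m]%SET)%SET -> B j = setT.
  move=> jh; apply/seteqP; split => // x _ i hi.
  by move: jh; rewrite -hi imset_f.
have mB j : measurable (B j).
  have [/imsetP[i _ ->]|/BT->//] := boolP (j \in (h @: [set: 'I_m]%SET)%SET).
  by rewrite BhE -[X in measurable X]setTI; exact: (mf measurableT _ (mA i)).
transitivity (iid_law P n (box B)).
  congr (iid_law P n _); apply/seteqP; split => x /= Ax.
    by move=> j i /= <-; have := Ax i; rewrite tnth_mktuple.
  by move=> i; rewrite tnth_mktuple; exact: Ax.
rewrite iid_law_box// (bigID (fun j => j \in (h @: [set: 'I_m]%SET)%SET))/=.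
rewrite [X in (_ * X)%E]big1 ?mule1 => [|j jh]; last first.
  by rewrite BT// probability_setT.
rewrite big_imset/=; last by move=> i j _ _; exact: injh.
by apply: eq_big => [i|i _]; rewrite ?inE// BhE QE.
Qed.
End reindex.

Section halves.
Context {d} {T : measurableType d} {R : realType}.

Definition join_halves m (z : m.-tuple T * m.-tuple T) : (m + m).-tuple T :=
  [tuple of z.1 ++ z.2].

Lemma measurable_join_halves m : measurable_fun setT (@join_halves m).
Proof.
apply/measurable_fun_tnthP => i; case: (split_ordP i) => j ->.
  rewrite (_ : _ \o _ = (@tnth m T ^~ j) \o fst).
    exact: (measurableT_comp (measurable_tnth j) measurable_fst).
  by apply/funext => x /=; rewrite tnth_lshift.
rewrite (_ : _ \o _ = (@tnth m T ^~ j) \o snd).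
  exact: (measurableT_comp (measurable_tnth j) measurable_snd).
by apply/funext => x /=; rewrite tnth_rshift.
Qed.

Lemma iid_law_join_halves m (P : probability T R) (E : set ((m + m).-tuple T)) :
  measurable E ->
  ((iid_law P m \x iid_law P m) (@join_halves m @^-1` E) =
   iid_law P (m + m) E)%E.
Proof.
move=> mE.
pose F : {mfun (m.-tuple T * m.-tuple T)%type >-> (m + m).-tuple T} :=
  mfun_Sub (mem_set (@measurable_join_halves m)).
rewrite -(@iid_law_unique _ _ _ _ _
  (distribution (iid_law P m \x iid_law P m)%E F))// => A mA.
have mbox (h : 'I_m -> 'I_(m + m)) : measurable (box (A \o h)).
  by apply: measurable_box => i; exact: mA.
rewrite big_split_ord/= -(iid_law_box P (fun i => mA (lshift m i))).
rewrite -(iid_law_box P (fun i => mA (rshift m i))) -product_measure1E;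
  [|exact: (mbox (lshift m))|exact: (mbox (@rshift m m))].
congr ((_ \x _)%E _); apply/seteqP; split => [[x y] /= Axy|[x y] /= [Ax Ay] i].
  split=> i /=; first by have := Axy (lshift m i); rewrite tnth_lshift.
  by have := Axy (rshift m i); rewrite tnth_rshift.
by case: (split_ordP i) => j ->; rewrite (tnth_lshift, tnth_rshift).
Qed.

End halves.

(** * Many hits of a set of positive mass, by blocks *)

Section block_hits.
Context {d} {T : measurableType d} {R : realType}.

Lemma card_block k L j : (j < k)%N ->
  (L <= #|[pred i : 'I_(k * L) | i %/ L == j]|)%N.
Proof.
move=> jk; case: L => // L; set A := [pred i | _].
have lt_kL (i : 'I_L.+1) : (j * L.+1 + i < k * L.+1)%N.
  by apply: (@leq_trans (j.+1 * L.+1)); rewrite ?leq_mul2r// mulSnr ltn_add2l.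
pose f i := Ordinal (lt_kL i).
have injf : injective f.
  by move=> i i' /(congr1 val)/= /addnI /val_inj.
rewrite -[X in (X <= _)%N]card_ord -(fintype.card_image injf).
apply: subset_leq_card; apply/fintype.subsetP => _ /fintype.imageP[i _ ->].
by rewrite inE /= divnMDl// divn_small// addn0.
Qed.

(* Cutting the sample into k blocks of length L, each block misses E with
   probability at most (1 - e)^L; this replaces a binomial tail bound. *)
Lemma block_hits (P : probability T R) k L (E : set T) (e : R) :
  measurable E -> 0 <= e <= 1 -> (e%:E <= P E)%E ->
  k%:R * (1 - e) ^+ L <= 2^-1 ->
  exists D : set ((k * L).-tuple T), [/\ measurable D,
    ((2^-1 : R)%:E <= iid_law P (k * L) D)%E &
    forall y, D y -> (k <= #|[pred i | tnth y i \in E]|)%N].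
Proof.
move=> mE /andP[e0 e1] eE keL.
pose miss j :=
  box (fun i : 'I_(k * L) => if (i %/ L)%N == j then ~` E else setT).
have mmiss j : measurable (miss j).
  by apply: measurable_box => i; case: ifP => // _; exact: measurableC.
have PE : P (~` E) = (1 - fine (P E))%:E.
  by rewrite probability_setC// EFinB fineK// fin_num_measure.
have eE' : e <= fine (P E) by rewrite -lee_fin fineK// fin_num_measure.
have E1 : fine (P E) <= 1.
  by rewrite -lee_fin fineK ?probability_le1// fin_num_measure.
have Pmiss j : (j < k)%N -> (iid_law P (k * L) (miss j) <= ((1 - e) ^+ L)%:E)%E.
  move=> jk; rewrite iid_law_box; last first.
    by move=> i; case: ifP => // _; exact: measurableC.
  rewrite (eq_bigr (fun i : 'I_(k * L) =>
      (if (i %/ L)%N == j then 1 - fine (P E) else 1)%:E)); last first.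
    by move=> i _; case: ifP => _ //; rewrite probability_setT.
  rewrite prodEFin lee_fin -big_mkcond/= prodr_const.
  apply: (@le_trans _ _ ((1 - fine (P E)) ^+ L)).
    apply: ler_wiXn2l; rewrite ?subr_ge0 ?gerBl ?(le_trans e0)//.
    exact: card_block.
  by rewrite lerXn2r ?nnegrE ?subr_ge0// lerB.
exists (~` \big[setU/set0]_(j < k) miss j); split.
- by apply: measurableC; exact: bigsetU_measurable.
- rewrite probability_setC; last exact: bigsetU_measurable.
  have : (iid_law P (k * L) (\big[setU/set0]_(j < k) miss j)
      <= (2^-1 : R)%:E)%E.
    apply: le_trans (Boole_inequality _ (fun j _ => mmiss j)) _.
    apply: (@le_trans _ _ (\sum_(j < k) ((1 - e) ^+ L)%:E)%E).
      by apply: lee_sum => j _; exact: Pmiss (ltn_ord j).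
    by rewrite sumEFin lee_fin sumr_const card_ord -[leLHS]mulr_natl.
  move=> h; rewrite (_ : 2^-1 = 1 - 2^-1 :> R); last by lra.
  by rewrite EFinB leeB.
- move=> y Dy; set S := [pred i | _].
  case: k => [//|k] in miss mmiss Pmiss y Dy S keL *.
  case: L => [|L] in miss mmiss Pmiss y Dy S keL *.
    (* Blocks of length 0 would turn the hypothesis into k <= 1/2. *)
    exfalso; move: keL; rewrite expr0 mulr1.
    have : 1 <= k.+1%:R :> R by rewrite ler1n.
    lra.
  (* When every block is hit, [blk] maps the hits onto all blocks, so there are at least as many
     hits as blocks. *)
  pose blk (i : 'I_(k.+1 * L.+1)) : 'I_k.+1 := inord (i %/ L.+1).
  have blkE i : blk i = (i %/ L.+1)%N :> nat by rewrite inordK// ltn_divLR.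
  rewrite -[X in (X <= _)%N]card_ord -cardsT.
  apply: leq_trans (leq_imset_card blk (mem S)).
  apply: subset_leq_card; apply/fintype.subsetP => j _.
  move: Dy; apply: contra_notP => jS.
  rewrite -bigcup_mkord; exists j => //= i.
  case: eqP => // ij iE; apply: jS; apply/imsetP; exists i.
    exact: (mem_set iE).
  by apply/val_inj => /=; rewrite blkE.
Qed.

End block_hits.

(** * Counting the traces of a VC class on a sample *)

Section vc_trace.
Context {d} {T : measurableType d}.

Lemma card_imset_ord (n : nat) (I : {set 'I_n}) (f : 'I_n -> T) :
  {in I &, injective f} -> ([set f i | i in [set` I]] #= `I_#|I|)%card.
Proof.
move=> injf.
have cardI : (`I_#|I| #= [set: 'I_#|I|])%card.
  have -> : `I_#|I| = [set nat_of_ord i | i in [set: 'I_#|I|]].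
    apply/seteqP; split => [k kI|_ [i _ <-]]; last exact: (ltn_ord i).
    by exists (Ordinal kI).
  by apply: inj_card_eq => i j _ _; exact: val_inj.
have -> : [set f i | i in [set` I]] =
    [set f (enum_val i) | i in [set: 'I_#|I|]].
  apply/seteqP; split => [_ [i iI <-]|_ [i _ <-]].
    by exists (enum_rank_in iI i) => //; rewrite enum_rankK_in.
  by exists (enum_val i) => //=; exact: enum_valP.
rewrite card_eq_sym; apply: (card_eq_trans cardI); rewrite card_eq_sym.
apply: inj_card_eq => i j _ _ /injf fij; apply: enum_val_inj.
by apply: fij; exact: enum_valP.
Qed.

Lemma card_trace (C : set (set T)) v n (x : n.-tuple T) :
  (forall A k, (A #= `I_k)%card -> shatters C A -> (k <= v)%N) ->
  (#|[set b : n.-tuple bool | `[< trace_event C b x >]]%SET| <= n.+1 ^ v)%N.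
Proof.
move=> vcC; apply: sauer_shelah => I sI.
apply: (vcC [set tnth x i | i in [set` I]]).
  apply: card_imset_ord => i j iI jI xij.
  (* Repeated sample points cannot both lie in a shattered index set: the pattern true only at [i]
     would separate them. *)
  have [t] := sI (fun k => k == i).
  rewrite inE => /asboolP[c _ cx] tE; apply/eqP.
  rewrite eq_sym -(tE _ jI); apply/cx; rewrite -xij; apply/cx.
  by rewrite tE// eqxx.
move=> B BA; have [t] := sI (fun k => `[< B (tnth x k) >]).
rewrite inE => /asboolP[c Cc cx] tE; exists c => //.
apply/seteqP; split => [_ [[i iI <-] /cx]|y By].
  by rewrite tE// => /asboolP.
have [i iI xi] := BA _ By; rewrite -xi in By *; split; first by exists i.
by apply/cx; rewrite tE//; exact/asboolP.
Qed.

End vc_trace.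

(** * Double sampling for a VC class with a fixed target *)

Section double_sample.
Context {d} {T : measurableType d} {R : realType}.
Variables (C : set (set T)) (c0 : set T) (v : nat).
Hypothesis Cm : C `<=` measurable.
Hypothesis Cc0 : C c0.
Hypothesis C_trace : sample_measurable R C.
Hypothesis C_vc :
  forall A k, (A #= `I_k)%card -> shatters C A -> (k <= v)%N.

Definition pattern (c : set T) n (x : n.-tuple T) : n.-tuple bool :=
  [tuple `[< c (tnth x i) >] | i < n].

Lemma trace_eventE n (b : n.-tuple bool) x :
  trace_event C b x <-> exists2 c, C c & pattern c x = b.
Proof.
split=> -[c Cc cx]; exists c => //.
  by apply: eq_from_tnth => i; rewrite tnth_mktuple; apply/asboolP/idP => /cx.
by move=> i; rewrite -cx tnth_mktuple; split => /asboolP.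
Qed.

Lemma measurable_pattern n (a : n.-tuple bool) :
  measurable [set x | pattern c0 x = a].
Proof.
rewrite (_ : [set x | _] = box (fun i => if tnth a i then c0 else ~` c0)).
  apply: measurable_box => i; case: ifP => _; first exact: Cm.
  by apply: measurableC; exact: Cm.
apply/seteqP; split => x /=.
  by move=> <- i; rewrite tnth_mktuple; case: asboolP.
move=> xa; apply: eq_from_tnth => i; rewrite tnth_mktuple.
by have := xa i; case: ifP => _ ?; [rewrite asboolT|rewrite asboolF].
Qed.

Definition errors n (a b : n.-tuple bool) i := tnth a i != tnth b i.

Definition late_failure m k : set ((m + m).-tuple T) :=
  [set z | exists2 c, C c &
    late_errors k (errors (pattern c z) (pattern c0 z))].

Arguments late_failure : clear implicits.

(** [late_failure] is a union over all of [C] and need not be measurable. It is also a finite union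
    over pairs of patterns, and each trace event in it is measurable up to a null set. *)
Lemma late_failure_sandwich (P : probability T R) m k : exists Bi Bo,
  [/\ measurable Bi, measurable Bo, Bi `<=` late_failure m k,
      late_failure m k `<=` Bo &
      iid_law P (m + m) Bi = iid_law P (m + m) Bo].
Proof.
pose A b := projT1 (cid2 (C_trace P (b : (m + m).-tuple bool))).
have mA b : measurable (A b) by rewrite /A; case: cid2.
have AN b : (iid_law P (m + m)).-negligible (A b `+` trace_event C b).
  by rewrite /A; case: cid2.
pose D : set ((m + m).-tuple bool * (m + m).-tuple bool) :=
  [set ab | late_errors k (errors ab.1 ab.2)].
pose B := \bigcup_(ab in D) (A ab.1 `&` [set z | pattern c0 z = ab.2]).
have mB : measurable B.
  apply: fin_bigcup_measurable; first exact: finite_finset.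
  by move=> ab _; apply: measurableI => //; exact: measurable_pattern.
(* A single null set [N] covers the errors of all patterns; enumerating these by [unpickle] turns
   the union into a countable one. *)
have [N [mN N0 BN]] : (iid_law P (m + m)).-negligible
    (\bigcup_n if unpickle n is Some b then A b `+` trace_event C b else set0).
  apply: negligible_bigcup => n; case: unpickle => //.
  exact: negligible_set0.
have subN b : A b `+` trace_event C b `<=` N.
  by move=> z bz; apply: BN; exists (pickle b) => //; rewrite pickleK.
exists (B `\` N), (B `|` N); split.
- exact: measurableD.
- exact: measurableU.
- move=> z [[[b a] /= Dab [Abz az]] Nz].
  have : trace_event C b z.
    by apply: contrapT => bz; apply: Nz; apply: (subN b); left.
  move=> /trace_eventE[c Cc cz]; exists c => //.
  by rewrite cz az.
- move=> z [c Cc cz]; have [Nz|Nz] := pselect (N z); first by right.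
  left; exists (pattern c z, pattern c0 z) => //; split => //=.
  apply: contrapT => Az; apply: Nz; apply: (subN (pattern c z)); right.
  by split => //; apply/trace_eventE; exists c.
- have NR : iid_law P (m + m) (B `&` N) = 0%E.
    by apply: subset_measure0 N0 => //; exact: measurableI.
  rewrite measureU0// [RHS](measureDI _ mB mN)//=.
  by rewrite NR adde0. 
Qed.

(* Swapping the i-th points of the two halves, for i in s, preserves the law; at
   each fixed sample, each of the at most (2m+1)^v patterns is a late failure
   for at most a fraction 2^-k of the swaps. *)
Lemma late_failure_le (P : probability T R) m k E :
  measurable E -> E `<=` late_failure m k ->
  (iid_law P (m + m) E <= ((m + m).+1%:R ^+ v / 2 ^+ k)%:E)%E.
Proof.
move=> mE EF; set N := (m + m)%N.
pose r (s : {set 'I_m}) : N.-tuple T -> N.-tuple T :=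
  reindex (swap_halves s) id.
pose F s := r s @^-1` E.
have mF s : measurable (F s).
  rewrite -[F s]setTI; exact: measurable_reindex.
have FE s : iid_law P N (F s) = iid_law P N E.
  by apply: iid_law_reindex => //; exact: swap_halves_inj.
(* Pointwise count of the swaps that bring [z] into [E]: at most one union over the traces, each
   with at most 2^(m-k) swaps. *)
have bound z : \sum_(s : {set 'I_m}) \1_(F s) z <=
    N.+1%:R ^+ v * 2 ^+ m / 2 ^+ k :> R.
  rewrite ler_pdivlMr ?exprn_gt0// -!natrX -natrM.
  have -> : \sum_(s : {set 'I_m}) \1_(F s) z =
      #|[pred s | z \in F s]|%:R :> R.
    rewrite -sum1_card natr_sum [RHS]big_mkcond/=; apply: eq_bigr => s _.
    by rewrite indicE -[s \in _]/(z \in F s); case: (z \in F s).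
  rewrite -natrM ler_nat; set W := [set b | `[< trace_event C b z >]]%SET.
  pose S b := [set s | late_errors k
    (errors b (pattern c0 z) \o @swap_halves m s)]%SET.
  apply: (@leq_trans ((\sum_(b in W) #|S b|) * 2 ^ k)).
    rewrite leq_mul2r; apply/orP; right.
    apply: leq_trans (unstable.card_big_setU _ _ _).
    apply: subset_leq_card; apply/fintype.subsetP => s.
    rewrite inE => /EF [c Cc cs]; apply/finset.bigcupP.
    exists (pattern c z).
      by rewrite inE; apply/asboolP/trace_eventE; exists c.
    rewrite inE; move: cs; congr late_errors; apply/funext => i.
    by rewrite /errors /= !tnth_mktuple.
  rewrite big_distrl/=.
  apply: (@leq_trans (\sum_(b in W) 2 ^ m)%N).
    by apply: leq_sum => b _; exact: card_swaps_late_errors.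
  by rewrite sum_nat_const leq_mul2r card_trace// orbT.
have mI s : measurable_fun [set: N.-tuple T] (EFin \o (\1_(F s) : _ -> R)).
  by apply/measurable_EFinP; apply/measurable_indicP.
(* Integrating the count: all 2^m sets [F s] have the same mass as [E]. *)
have : ((2 ^+ m)%:E * iid_law P N E <=
    (N.+1%:R ^+ v * 2 ^+ m / 2 ^+ k)%:E)%E.
  have <- : (\int[iid_law P N]_z (\sum_(s : {set 'I_m}) (\1_(F s) z)%:E) =
      (2 ^+ m)%:E * iid_law P N E)%E.
    rewrite ge0_integral_sum//.
    have pE : iid_law P N E = (fine (iid_law P N E))%:E.
      by rewrite fineK// fin_num_measure.
    rewrite (eq_bigr (fun=> (fine (iid_law P N E))%:E)) => [|s _]; last first.
      by rewrite integral_indic// setIT -pE; exact: FE.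
    rewrite sumEFin sumr_const -cardsT -powersetT card_powerset cardsT card_ord.
    by rewrite pE -EFinM -natrX mulr_natl.
  apply: (@le_trans _ _ (\int[iid_law P N]_z
    (cst (N.+1%:R ^+ v * 2 ^+ m / 2 ^+ k)%:E) z)%E); last first.
    rewrite integral_cst// [X in (_ * X)%E](_ : _ = 1%E) ?mule1//.
    exact: probability_setT.
  apply: ge0_le_integral => //.
  - by move=> z _; apply: sume_ge0 => s _; rewrite lee_fin.
  - by apply: emeasurable_sum => s; exact: mI.
  - by move=> z _; have := bound z; rewrite -lee_fin -sumEFin.
rewrite -[in X in _ -> X](@lee_pmul2l _ (2 ^+ m)%:E)// ?lte_fin ?exprn_gt0//.
by rewrite -EFinM mulrA (mulrC (2 ^+ m)).
Qed.


Lemma setYP (A B : set T) x : (A `+` B) x <-> `[< A x >] != `[< B x >].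
Proof.
split=> [[] [Ax Bx]|]; first by rewrite asboolT// asboolF.
  by rewrite asboolF// asboolT.
by case: asboolP => Ax; case: asboolP => Bx // _; [left|right].
Qed.

Lemma late_failure_join m k c (x y : m.-tuple T) : C c ->
  pattern c x = pattern c0 x ->
  (k <= #|[pred i | tnth y i \in (c `+` c0)]|)%N ->
  late_failure m k (join_halves (x, y)).
Proof.
move=> Cc cx hk; exists c => //; apply/andP; split.
  apply/forallP => i; rewrite negbK /errors !tnth_mktuple !tnth_lshift.
  by have := congr1 (fun t => tnth t i) cx; rewrite !tnth_mktuple => ->.
apply: leq_trans hk _; apply: subset_leq_card; apply/fintype.subsetP => i.
rewrite !inE /errors !tnth_mktuple !tnth_rshift.
by move=> /setYP.
Qed.

(** If [c] is far from [c0] but has its trace on the first half, at least half of the second halves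
    complete a late failure. By Markov's inequality, the first halves whose completions fall in [Bo]
    with probability at least 1/2 have mass at most twice that of [Bo], whence the factor 2. The
    complement serves all [c] at once. *)
Lemma consistent_close (P : probability T R) k L (e delta : R) :
  0 <= e <= 1 -> k%:R * (1 - e) ^+ L <= 2^-1 ->
  2 * ((k * L + k * L).+1%:R ^+ v / 2 ^+ k) <= delta ->
  exists G : set ((k * L).-tuple T), [/\ measurable G,
    ((1 - delta)%:E <= iid_law P (k * L) G)%E &
    forall x c, G x -> C c -> pattern c x = pattern c0 x ->
      (P (c `+` c0) < e%:E)%E].
Proof.
set m := (k * L)%N => e01 keL kd.
have [Bi [Bo [mBi mBo Bi_bad bad_Bo BiBo]]] :=
  late_failure_sandwich P m k.
have BoE : (iid_law P (m + m) Bo <= ((m + m).+1%:R ^+ v / 2 ^+ k)%:E)%E.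
  by rewrite -BiBo; exact: late_failure_le.
pose A := @join_halves _ T m @^-1` Bo.
have mA : measurable A.
  by rewrite -[A]setTI; exact: measurable_join_halves.
pose g := iid_law P m \o xsection A.
have mg : measurable_fun [set: m.-tuple T] g by exact: measurable_fun_xsection.
pose F := [set x | ((2^-1)%:E <= `|g x|)%E].
have mF : measurable F.
  rewrite -[F]setTI; apply: emeasurable_fun_c_infty => //.
  exact: measurableT_comp.
have FE : (iid_law P m F <= delta%:E)%E.
  have h2 : 0 < 2^-1 :> R by rewrite invr_gt0.
  have := le_integral_abse (iid_law P m) measurableT mg h2.
  rewrite setTI (eq_integral g) => [|x _]; last by rewrite gee0_abs.
  rewrite [X in (_ <= X)%E -> _](iid_law_join_halves P mBo) => FBo.
  rewrite -(@lee_pmul2l _ (2^-1)%:E)// ?lte_fin// (le_trans FBo)//.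
  rewrite (le_trans BoE)// -EFinM lee_fin.
  by move: kd; lra.
exists (~` F); split; first exact: measurableC.
  by rewrite probability_setC// EFinB leeB.
move=> x c Fx Cc cx; rewrite ltNge; apply/negP => ec.
have mE : measurable (c `+` c0).
  by apply: measurableU; apply: measurableD; exact: Cm.
have [D [mD D2 hD]] := block_hits mE e01 ec keL.
apply: Fx; rewrite /F/= gee0_abs// (le_trans D2)//.
apply: le_measure; rewrite ?inE//; first exact: measurable_xsection.
move=> y /hD hy; apply/mem_set/bad_Bo.
  exact: (late_failure_join Cc cx hy).
Qed.

End double_sample.

(** * Arithmetic of the sample sizes *)

Section sample_size.
Context {R : realType}.
Implicit Types (v : nat) (e delta : R).

Definition complexity v e delta : R := (v%:R + ln (1 / delta)) / e.

(* With G = complexity + 2, block_size makes a block miss with probability at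
   most G^-6 <= 1 / (2 num_blocks); then 2m + 1 <= G^11, and num_blocks
   outweighs the union bound over the (2m+1)^v traces. *)
Definition num_blocks v e delta : nat :=
  (Num.truncn
    (32 * (v%:R + ln (1 / delta)) * ln (complexity v e delta + 2))).+1.

Definition block_size v e delta : nat :=
  (Num.truncn (12 * (ln (complexity v e delta + 2) / e))).+1.

(* For v = 0 the class is a single set and no sample is needed; a positive
   size would exceed the claimed bound, which vanishes as delta tends to 1. *)
Definition sample_size v e delta : nat :=
  if v is 0 then 0 else (num_blocks v e delta * block_size v e delta)%N.

Lemma truncnS_bounds (x : R) : 0 <= x ->
  x <= (Num.truncn x).+1%:R /\ (Num.truncn x).+1%:R <= x + 1.
Proof.
move=> x0; have /andP[h1 h2] := truncn_itv x0; split; first exact: ltW.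
by rewrite -addn1 natrD lerD2r.
Qed.

(** This is ln y <= y - 1 at y = 1/x. *)
Lemma ln_ge_1BV (x : R) : 0 < x -> 1 - x^-1 <= ln x.
Proof.
move=> x0; have : ln (1 + (x^-1 - 1)) <= x^-1 - 1.
  by apply: le_ln1Dx; rewrite ltrBrDl subrr invr_gt0.
by rewrite addrC subrK lnV ?posrE//; lra.
Qed.

Section bounds.
Variables (v : nat) (e delta : R).
Hypotheses (v_gt0 : (0 < v)%N) (e01 : 0 < e < 1) (d01 : 0 < delta < 1).

Let t := ln (1 / delta).
Let s := v%:R + t.
Let G := complexity v e delta + 2.
Let l := ln G.

Let e0 : 0 < e. Proof. by case/andP: e01. Qed.
Let e1 : e < 1. Proof. by case/andP: e01. Qed.
Let d0 : 0 < delta. Proof. by case/andP: d01. Qed.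

Let t0 : 0 <= t.
Proof.
by apply: ln_ge0; rewrite div1r invf_ge1//; case/andP: d01 => _ /ltW.
Qed.

Let v1 : 1 <= v%:R :> R. Proof. by rewrite ler1n. Qed.

Let s1 : 1 <= s. Proof. by rewrite /s; move: v1 t0; lra. Qed.

Let sG : s <= G.
Proof.
rewrite /G /complexity -/t -/s.
suff : s <= s / e by lra.
by rewrite ler_pdivlMr// ler_piMr ?(le_trans _ s1)// ltW.
Qed.

Let ieG : e^-1 <= G.
Proof.
rewrite /G /complexity -/t -/s.
suff : e^-1 <= s / e by lra.
by rewrite ler_peMl// invr_ge0 ltW.
Qed.

Let G3 : 3 <= G.
Proof.
have : 1 <= e^-1 by rewrite invf_ge1// ltW.
have : e^-1 <= s / e by rewrite ler_peMl// invr_ge0 ltW.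
by rewrite /G /complexity -/t -/s; lra.
Qed.

Let G0 : 0 < G. Proof. by move: G3; lra. Qed.

Let l23 : 2 / 3 <= l.
Proof.
have h := ln_ge_1BV G0; have : G^-1 <= 3^-1 by rewrite lef_pV2 ?posrE.
by rewrite /l; lra.
Qed.

Let lG : l <= G.
Proof.
have : ln (1 + (G - 1)) <= G - 1 by apply: le_ln1Dx; move: G3; lra.
by rewrite addrC subrK -/l; lra.
Qed.

Let sl : 2 / 3 <= s * l.
Proof. by move: s1 l23; nra. Qed.

Let lie : 2 / 3 <= l / e.
Proof.
have : 1 <= e^-1 by rewrite invf_ge1// ltW.
by move: l23; nra.
Qed.

(** As s * l >= 2/3, the 1 lost in rounding up is at most 2 * s * l; [LE] goes from 12 to 14
    likewise. *)
Let kE : 32 * s * l <= (num_blocks v e delta)%:R <= 34 * (s * l).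
Proof.
rewrite /num_blocks -/t -/s -/G -/l.
have [|h1 h2] := @truncnS_bounds (32 * s * l); first by move: sl; lra.
by rewrite h1 (le_trans h2)//; move: sl; lra.
Qed.

Let LE : 12 * (l / e) <= (block_size v e delta)%:R <= 14 * (l / e).
Proof.
rewrite /block_size -/G -/l.
have [|h1 h2] := @truncnS_bounds (12 * (l / e)); first by move: lie; lra.
by rewrite h1 (le_trans h2)//; move: lie; lra.
Qed.

(** 476 = 34 * 14, and each of the two factors contributes one logarithm. *)
Lemma sample_size_le :
  (num_blocks v e delta * block_size v e delta)%:R <=
  soft_O 476 2 (complexity v e delta).
Proof.
rewrite natrM /soft_O -/G -/l.
rewrite (_ : 476 * _ * _ = (34 * (s * l)) * (14 * (l / e))).
  by case/andP: kE => _ k2; case/andP: LE => _ L2; rewrite ler_pM.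
by rewrite /complexity -/t -/s; lra.
Qed.

Let GE n : G ^+ n = expR (n%:R * l).
Proof. by rewrite expRM_natl lnK. Qed.

(** Here 2k <= 68 G^2, and 68 <= 3^4 <= G^4. *)
Let kG : 2 * (num_blocks v e delta)%:R <= G ^+ 6.
Proof.
case/andP: kE => _ k2.
have : s * l <= G ^+ 2 by rewrite expr2 ler_pM//; [move: s1|move: l23]; lra.
have : 3 ^+ 4 <= G ^+ 4 by rewrite lerXn2r ?nnegrE// ltW.
rewrite (_ : 6 = 4 + 2)%N// exprD.
have : 0 <= G ^+ 2 by rewrite exprn_ge0// ltW.
by nra.
Qed.

(** With L >= 12 l / e, (1 - e/2)^L <= exp(- e L / 2) <= exp(- 6 l) = G^-6. *)
Lemma block_miss_le :
  (num_blocks v e delta)%:R * (1 - e / 2) ^+ block_size v e delta <= 2^-1.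
Proof.
have miss : (1 - e / 2) ^+ block_size v e delta <= (G ^+ 6)^-1.
  rewrite GE -expRN.
  apply: (@le_trans _ _ (expR (- (e / 2)) ^+ block_size v e delta)).
    rewrite lerXn2r ?nnegrE ?expR_ge0//; first by move: e1; lra.
    exact: expR_ge1Dx.
  rewrite -expRM_natl ler_expR mulrN lerN2.
  case/andP: LE => L1 _.
  apply: (@le_trans _ _ (12 * (l / e) * (e / 2))).
    by rewrite le_eqVlt; apply/orP; left; apply/eqP; field; rewrite gt_eqF.
  by rewrite ler_wpM2r//; move: e0; lra.
apply: (le_trans (ler_wpM2l _ miss)) => //.
by rewrite ler_pdivrMr ?exprn_gt0// -ler_pdivrMl ?invr_gt0// invrK.
Qed.

Lemma union_bound_le m : m = (num_blocks v e delta * block_size v e delta)%N ->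
  2 * ((m + m).+1%:R ^+ v / 2 ^+ num_blocks v e delta) <= delta / 2.
Proof.
move=> mE.
have pow n : 3 ^+ n <= G ^+ n by rewrite lerXn2r ?nnegrE// ltW.
(* From m <= 476 G^4 follows 2m + 1 <= 953 G^4, and 953 <= 3^7 <= G^7. *)
have mG : (m + m).+1%:R <= G ^+ 11.
  have sl2 : s * l <= G ^+ 2.
    by rewrite expr2 ler_pM//; [move: s1|move: l23]; lra.
  have le2 : l / e <= G ^+ 2.
    by rewrite expr2 ler_pM// ?invr_ge0 1?ltW//; move: l23; lra.
  have m_le : m%:R <= 476 * G ^+ 4.
    rewrite mE natrM.
    rewrite (_ : 476 * _ = (34 * G ^+ 2) * (14 * G ^+ 2)); last by ring.
    case/andP: kE => _ k2; case/andP: LE => _ L2.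
    by rewrite ler_pM// ?(le_trans k2) ?(le_trans L2)// ler_wpM2l.
  rewrite -natr1 natrD (_ : 11 = 7 + 4)%N// exprD.
  have := pow 7%N; have := pow 4%N; nra.
have dE : delta = expR (- t).
  by rewrite /t div1r lnV ?posrE// opprK lnK.
(* Absorbing 4 into G^4, the exponents compare as (4 + 11 v) l + t <= 16 (v + t) l, by v >= 1 and l
   >= 2/3. *)
have key : 4 * G ^+ 11 ^+ v <= delta * expR (16 * s * l).
  apply: (@le_trans _ _ (G ^+ 4 * G ^+ 11 ^+ v)).
    by rewrite ler_wpM2r ?exprn_ge0 1?ltW//; have := pow 4%N; lra.
  rewrite dE -exprM -exprD GE -expRD ler_expR natrD natrM /s.
  by move: v1 t0 l23; nra.
(* Since exp(1/2) <= 2, half of k >= 32 s l is enough. *)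
have k2 : expR (16 * s * l) <= 2 ^+ num_blocks v e delta.
  have h2 : expR (2^-1) <= 2 :> R.
    rewrite -[leRHS]lnK ?posrE// ler_expR.
    by have := @ln_ge_1BV 2 (ltr0n _ 2); lra.
  apply: (@le_trans _ _ (expR (2^-1) ^+ num_blocks v e delta)).
    by rewrite -expRM_natl ler_expR; case/andP: kE => + _; lra.
  by rewrite lerXn2r ?nnegrE ?expR_ge0.
have mGv : (m + m).+1%:R ^+ v <= G ^+ 11 ^+ v.
  by rewrite lerXn2r ?nnegrE ?exprn_ge0// ltW.
rewrite mulrA ler_pdivrMr ?exprn_gt0//.
have := ler_wpM2l (ltW d0) k2.
move: key mGv; move: (_ ^+ v) (_ ^+ v) (expR _) (2 ^+ _) => a b c K.
clear mE mG k2; lra.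
Qed.

End bounds.
End sample_size.

(** * From VC-dimension to samples that determine members of the class approximately *)

Section learning.
Context {R : realType}.

(** A nonempty class shatters the empty set, so the supremum is at least 0; being finite, it is
    attained. *)
Lemma vc_dim_nat T (C : set (set T)) : C !=set0 -> (vc_dim R C < +oo)%E ->
  exists2 v : nat, vc_dim R C = (v%:R)%:E &
    forall A k, (A #= `I_k)%card -> shatters C A -> (k <= v)%N.
Proof.
move=> [c Cc] Coo.
pose p n := `[< exists2 A : set T, (A #= `I_n)%card & shatters C A >].
have p0 : p 0%N.
  apply/asboolP; exists set0; first by rewrite II0.
  by move=> B; rewrite subset0 => ->; exists c; rewrite ?set0I.
have le_vc n : p n -> ((n%:R)%:E <= vc_dim R C)%E.
  by move=> /asboolP pn; apply: ereal_sup_ubound; exists n.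
have vc_fin : vc_dim R C \is a fin_num.
  by rewrite ge0_fin_numE//; exact: le_vc p0.
have p_le n : p n -> (n <= Num.truncn (fine (vc_dim R C)))%N.
  move=> pn; have vn := le_vc _ pn; rewrite -(fineK vc_fin) lee_fin in vn.
  have /andP[_ h] := truncn_itv (le_trans (ler0n R n) vn).
  by rewrite -ltnS -(ltr_nat R) (le_lt_trans vn).
case: (ex_maxnP (ex_intro p _ p0) p_le) => v pv vmax; exists v.
  apply/eqP; rewrite eq_le le_vc// andbT; apply: ge_ereal_sup => _ [n pn <-].
  by rewrite lee_fin ler_nat vmax//; exact/asboolP.
by move=> A k Ak sA; apply: vmax; apply/asboolP; exists A.
Qed.

Lemma sample_size_soft_O v (e delta : R) : 0 < e < 1 -> 0 < delta < 1 ->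
  (sample_size v e delta)%:R <= soft_O 476 2 ((v%:R + ln (1 / delta)) / e).
Proof.
move=> e01 d01; case: v => [|v]; last exact: sample_size_le.
case/andP: e01 => e0 _; case/andP: d01 => d0 d1.
have g0 : 0 <= (0%:R + ln (1 / delta)) / e.
  by rewrite divr_ge0 ?(ltW e0)// add0r ln_ge0// div1r invf_ge1// ltW.
apply: mulr_ge0; first by apply: mulr_ge0 g0; exact: ler0n.
by apply/exprn_ge0/ln_ge0; move: g0; move: (_ / e) => g; lra.
Qed.

(** A point in one member but not in another would be a shattered singleton. *)
Lemma vc0_subsingleton T (C : set (set T)) c c' :
  (forall A k, (A #= `I_k)%card -> shatters C A -> (k <= 0)%N) ->
  C c -> C c' -> c = c'.
Proof.
move=> C0; suff sub a b : C a -> C b -> a `<=` b.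
  by move=> Cc Cc'; apply/seteqP; split; exact: sub.
move=> Ca Cb x ax; apply: contrapT => bx.
suff : (1 <= 0)%N by [].
apply: (C0 [set x]); first exact: card_set1.
move=> B /subset_set1[] ->.
  by exists b => //; apply/seteqP; split => // _ [-> /bx].
by exists a => //; apply/seteqP; split => [_ []//|_ ->].
Qed.

Section uniform_convergence.
Context {d d'} {T : measurableType d} {T' : measurableType d'}.
Variables (C : set (set T)) (c0 : set T) (v : nat).
Hypothesis Cm : C `<=` measurable.
Hypothesis Cc0 : C c0.
Hypothesis C_trace : sample_measurable R C.
Hypothesis C_vc :
  forall A k, (A #= `I_k)%card -> shatters C A -> (k <= v)%N.

Lemma sample_size_close (P : probability T R) (e delta : R) :
  0 < e < 1 -> 0 < delta < 1 ->
  exists G : set ((sample_size v e delta).-tuple T), [/\ measurable G,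
    ((1 - delta / 2)%:E <= iid_law P (sample_size v e delta) G)%E &
    forall x c, G x -> C c -> pattern c x = pattern c0 x ->
      (P (c `+` c0) <= (e / 2)%:E)%E].
Proof.
move=> e01 d01; have /andP[e0 e1] := e01; have /andP[d0 d1] := d01.
case: v C_vc => [|w] vcC.
  exists setT; split => //.
    by rewrite probability_setT lee_fin; lra.
  move=> x c _ Cc _.
  by rewrite (vc0_subsingleton vcC Cc Cc0) setYK measure0 lee_fin; lra.
have e2 : 0 <= e / 2 <= 1 by apply/andP; split; lra.
have [G [mG PG GC]] := consistent_close Cm Cc0 C_trace vcC P e2
  (block_miss_le (ltn0Sn w) e01 d01) (union_bound_le (ltn0Sn w) e01 d01 erefl).
by exists G; split => // x c Gx Cc cx; rewrite ltW// (GC x).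
Qed.

(* The samples are drawn from Q and seen through f; the event A collects what
   holds almost surely for each sample point. *)
Lemma good_sample (Q : probability T' R) (P : probability T R) (f : T' -> T)
    (A : set T') (e delta : R) p :
  measurable_fun [set: T'] f ->
  (forall B, measurable B -> P B = Q (f @^-1` B)) ->
  measurable A -> Q (~` A) = 0%E ->
  0 < e < 1 -> 0 < delta < 1 -> (sample_size v e delta <= p)%N ->
  exists E : set (p.-tuple T'), [/\ measurable E,
    ((1 - delta / 2)%:E <= iid_law Q p E)%E,
    forall S i, E S -> A (tnth S i) &
    forall S c, E S -> C c ->
      (forall i, c (f (tnth S i)) <-> c0 (f (tnth S i))) ->
      (P (c `+` c0) <= (e / 2)%:E)%E].
Proof.
move=> mf PQ mA QA e01 d01 mp.
have [G [mG PG GC]] := sample_size_close P e01 d01.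
(* Closeness is read off the first [sample_size] points only, so longer samples are covered; [B]
   constrains all [p] points. *)
pose r := reindex (widen_ord mp) f; pose B := box (fun _ : 'I_p => A).
have injw : injective (widen_ord mp).
  by move=> i j /(congr1 val)/= /val_inj.
have mrG : measurable (r @^-1` G).
  by rewrite -[X in measurable X]setTI; exact: measurable_reindex.
have mB : measurable B by exact: measurable_box.
have PB : iid_law Q p (~` B) = 0%E.
  rewrite probability_setC// iid_law_box// big1 ?subee// => i _.
  by rewrite -[A]setCK probability_setC ?QA ?sube0//; exact: measurableC.
exists (r @^-1` G `&` B); split.
- exact: measurableI.
- apply: (le_trans PG); rewrite -(iid_law_reindex injw mf PQ mG).
  have NB : iid_law Q p (r @^-1` G `\` B) = 0%E.
    have mGB : measurable (r @^-1` G `\` B) by exact: measurableD.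
    by apply: (subset_measure0 mGB (measurableC mB) _ PB) => x [].
  have := measureDI (iid_law Q p) mrG mB.
  by rewrite [X in (X + _)%E]NB add0e => ->.
- by move=> S i [_ BS]; exact: BS.
- move=> S c [rS _] Cc cS; apply: GC rS Cc _.
  apply: eq_from_tnth => i; rewrite !tnth_mktuple.
  by apply/asboolP/asboolP => /cS.
Qed.

End uniform_convergence.

Section robust_loss.
Context {d} {X : measurableType d}.
Variable U : X -> set X.
Implicit Types h : X -> bool.

Definition robust_errors h : set (X * bool) :=
  [set q | exists2 z, U q.1 z & h z <> q.2].

Lemma measurable_robust_errors h :
  measurable_fun [set: X * bool] (robust_loss U h : X * bool -> R) ->
  measurable (robust_errors h).
Proof. by move=> /measurable_indicP. Qed.

Lemma robust_riskE (P : probability (X * bool)%type R) h :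
  measurable (robust_errors h) -> robust_risk U P h = P (robust_errors h).
Proof. exact: expectation_indic. Qed.

Lemma measurable_hypothesis_set h :
  measurable_fun [set: X] h -> measurable [set x | h x].
Proof.
move=> mh; rewrite (_ : [set x | h x] = h @^-1` [set true]).
  by rewrite -[X in measurable X]setTI; exact: mh.
by apply/seteqP; split.
Qed.

Lemma measurable_fst_preimage (A : set X) :
  measurable A -> measurable (@fst X bool @^-1` A).
Proof.
by move=> mA; rewrite -[X in measurable X]setTI; exact: measurable_fst.
Qed.

(** The margin is the preimage of [robust_errors] under x |-> (x, h x). *)
Lemma measurable_margin h :
  measurable_fun [set: X] h -> measurable (robust_errors h) ->
  measurable (margin U h).
Proof.
move=> mh mE.
have := measurable_fun_pair (@measurable_id _ X setT) mh measurableT mE.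
by rewrite setTI; congr measurable; apply/seteqP;
  split => x [z Uz hz]; exists z => //; exact: nesym.
Qed.

End robust_loss.
End learning.

(** * The learner and its risk *)

Section learner.
Context {R : realType} {d} {X : measurableType d}.
Variables (U : X -> set X) (H : set (X -> bool)).
Implicit Types h : X -> bool.

Definition consistent (S : seq (X * bool)) (W : seq X) h :=
  {in S, forall q, h q.1 = q.2} /\ {in W, forall x, ~ margin U h x}.

(** The default [h0] keeps the learner proper on samples that no hypothesis fits. *)
Definition consistent_learner h0 S W : X -> bool :=
  if pselect (exists2 h, H h & consistent S W h) is left P
  then projT1 (cid2 P) else h0.

Lemma consistent_learner_in h0 S W : H h0 -> H (consistent_learner h0 S W).
Proof. by rewrite /consistent_learner; case: pselect => // P; case: cid2. Qed.

Lemma consistent_learnerP h0 h S W : H h -> consistent S W h ->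
  consistent S W (consistent_learner h0 S W).
Proof.
move=> Hh ch; rewrite /consistent_learner; case: pselect => [P|[]].
  by case: cid2.
by exists h.
Qed.

Hypothesis U_refl : forall x, U x x.

Lemma margin_sub_robust_errors h :
  fst @^-1` margin U h `<=` robust_errors U h.
Proof.
move=> [x y] [z /= Uz hz]; have [hx|hx] := eqVneq (h x) y.
  by exists z => //=; rewrite -hx; exact: nesym.
by exists x => //; exact/eqP.
Qed.

(** Outside both symmetric differences, a robust error of [h] is either a wrong label at [x], shared
    by [h'], or puts [x] in the margin of [h], hence of [h']. Both are robust errors of [h']. *)
Lemma robust_errors_sub h h' :
  robust_errors U h `<=`
    fst @^-1` ([set x | h x] `+` [set x | h' x]) `|`
    fst @^-1` (margin U h `+` margin U h') `|` robust_errors U h'.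
Proof.
move=> [x y] [z /= Uz hz].
have [|nhh'] := pselect (([set x | h x] `+` [set x | h' x]) x).
  by left; left.
have [|nmm'] := pselect ((margin U h `+` margin U h') x).
  by left; right.
right; have hh' : h x = h' x.
  by apply/idP/idP => hx; apply: contrapT => h'x; apply: nhh'; [left|right].
have [hx|/eqP hx] := eqVneq (h x) y; last first.
  by exists x => //=; rewrite -hh'.
apply: margin_sub_robust_errors => /=; apply: contrapT => nm.
apply: nmm'; left; split => //; exists z => //.
by rewrite hx; exact: nesym.
Qed.

Lemma robust_risk_le (P : probability (X * bool)%type R) h h' (e : R) :
  measurable_fun [set: X] h -> measurable_fun [set: X] h' ->
  measurable (robust_errors U h) -> measurable (robust_errors U h') ->
  P (robust_errors U h') = 0%E ->
  (marginal P ([set x | h x] `+` [set x | h' x]) <= (e / 2)%:E)%E ->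
  (marginal P (margin U h `+` margin U h') <= (e / 2)%:E)%E ->
  (robust_risk U P h <= e%:E)%E.
Proof.
move=> mh mh' mEh mEh' Ph' dh dm; rewrite robust_riskE//.
have mY (A B : set X) : measurable A -> measurable B -> measurable (A `+` B).
  by move=> mA mB; apply: measurableU; exact: measurableD.
have m1 := measurable_fst_preimage
  (mY _ _ (measurable_hypothesis_set mh) (measurable_hypothesis_set mh')).
have m2 := measurable_fst_preimage
  (mY _ _ (measurable_margin mh mEh) (measurable_margin mh' mEh')).
apply: (le_trans (le_measure P _ _ (@robust_errors_sub h h'))); rewrite ?inE//.
  by apply: measurableU => //; exact: measurableU.
apply: (le_trans (measureU2 _ (measurableU _ _ m1 m2) mEh')).
rewrite [X in (_ + X)%E]Ph' adde0 (le_trans (measureU2 _ m1 m2))//.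
by rewrite [e]splitr EFinD; exact: leeD.
Qed.

End learner.

Theorem theorem11 (R : realType) :
  exists (C : R) (k : nat),
  forall (d : measure_display) (X : measurableType d)
    (U : X -> set X) (H : set (X -> bool)),
  (forall x, U x x) ->
  (forall h : X -> bool, measurable_fun [set: X] h ->
     measurable_fun [set: X * bool] (robust_loss U h : X * bool -> R)) ->
  H !=set0 ->
  (forall h, H h -> measurable_fun [set: X] h) ->
  (vc_dim R (hypothesis_sets H) < +oo)%E ->
  (vc_dim R (margin_class U H) < +oo)%E ->
  sample_measurable R (hypothesis_sets H) ->
  sample_measurable R (margin_class U H) ->
  exists m n : R -> R -> nat,
  [/\ forall eps delta : R, 0 < eps < 1 -> 0 < delta < 1 ->
        (m eps delta)%:R <=
        soft_O C k ((fine (vc_dim R (hypothesis_sets H)) + ln (1 / delta)) / eps),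
      forall eps delta : R, 0 < eps < 1 -> 0 < delta < 1 ->
        (n eps delta)%:R <=
        soft_O C k ((fine (vc_dim R (margin_class U H)) + ln (1 / delta)) / eps) &
      properly_learnable U H (robust_realizable U H) m n].
Proof.
exists 476, 2 => d X U H U_refl loss_meas [h0 Hh0] H_meas vcH vcM sH sM.
have [vh vhE vcHP] : exists2 v : nat, vc_dim R (hypothesis_sets H) = (v%:R)%:E &
    forall A k, (A #= `I_k)%card ->
      shatters (hypothesis_sets H) A -> (k <= v)%N.
  by apply: vc_dim_nat => //; exists [set x | h0 x], h0.
have [vm vmE vcMP] : exists2 v : nat, vc_dim R (margin_class U H) = (v%:R)%:E &
    forall A k, (A #= `I_k)%card ->
      shatters (margin_class U H) A -> (k <= v)%N.
  by apply: vc_dim_nat => //; exists (margin U h0), h0.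
exists (sample_size vh), (sample_size vm); split.
- by move=> e delta e01 d01; rewrite vhE; exact: sample_size_soft_O.
- by move=> e delta e01 d01; rewrite vmE; exact: sample_size_soft_O.
exists (consistent_learner U H h0) => [S W|].
  exact: consistent_learner_in.
move=> e delta e01 d01 P [h Hh h_risk] p q mp nq.
have mE g : H g -> measurable (robust_errors U g).
  by move=> /H_meas /loss_meas /measurable_robust_errors.
have mM g : H g -> measurable (margin U g).
  by move=> Hg; apply: measurable_margin; [exact: H_meas|exact: mE].
have P_err : P (robust_errors U h) = 0%E by rewrite -robust_riskE//; exact: mE.
have P_mar : marginal P (margin U h) = 0%E.
  apply: (subset_measure0 (measurable_fst_preimage (mM _ Hh)) (mE _ Hh) _
    P_err).
  exact: margin_sub_robust_errors.
have Hset : hypothesis_sets H `<=` measurable.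
  by move=> _ [g Hg <-]; exact: measurable_hypothesis_set (H_meas _ Hg).
have Mset : margin_class U H `<=` measurable by move=> _ [g Hg <-]; exact: mM.
have Hh' : hypothesis_sets H [set x | h x] by exists h.
have Mh' : margin_class U H (margin U h) by exists h.
have [E1 [mE1 PE1 E1h E1c]] := good_sample Hset Hh' sH vcHP
  (P := marginal P) (Q := P) (f := fst) (A := ~` robust_errors U h)
  measurable_fst (fun _ _ => erefl) (measurableC (mE _ Hh))
  (etrans (congr1 P (setCK _)) P_err) e01 d01 mp.
have [E2 [mE2 PE2 E2h E2c]] := good_sample Mset Mh' sM vcMP
  (P := marginal P) (Q := marginal P) (f := id) (A := ~` margin U h)
  (@measurable_id _ X setT) (fun _ _ => erefl) (measurableC (mM _ Hh))
  (etrans (congr1 (marginal P) (setCK _)) P_mar) e01 d01 nq.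
exists (E1 `*` E2); split; first exact: measurableX.
  move=> [S W] [/= E1S E2W].
  (* The robust classifier itself fits the samples, so the learner does not fall back on [h0]. *)
  have h_cons : consistent U S W h.
    split=> [x /tnthP[i ->]|x /tnthP[i ->]]; last exact: E2h.
    apply: contrapT => hx; apply: (E1h S i E1S).
    by exists (tnth S i).1 => //; exact: U_refl.
  have [] := consistent_learnerP h0 Hh h_cons.
  have := consistent_learner_in U S W Hh0.
  set g := consistent_learner _ _ _ _ _ => Hg gS gW.
  apply: (@le_trans _ _ e%:E).
    apply: (@robust_risk_le _ _ _ _ U_refl P g h) => //.
    - exact: H_meas.
    - exact: H_meas.
    - exact: mE.
    - exact: mE.
    - apply: (E1c S) => // [|i]; first by exists g.
      have := gS _ (mem_tnth i S); have := h_cons.1 _ (mem_tnth i S).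
      by move=> /= -> ->.
    (* Both margins miss every unlabeled point, so their traces agree. *)
    - apply: (E2c W) => // [|i]; first by exists g.
      have := gW _ (mem_tnth i W); have := h_cons.2 _ (mem_tnth i W).
      by move=> /= ? ?; split.
  (* The best risk is nonnegative, so adding it only weakens the bound. *)
  rewrite leeDr//; apply/ereal_infP => _ [g' Hg' <-].
  by rewrite robust_riskE//; exact: mE.
rewrite [leRHS](product_measure1E _ _ mE1 mE2).
have d0 : 0 <= 1 - delta / 2 by case/andP: d01; lra.
(* The samples are independent, and (1 - delta/2)^2 >= 1 - delta. *)
apply: (@le_trans _ _ ((1 - delta / 2)%:E * (1 - delta / 2)%:E)%E).
  by rewrite -EFinM lee_fin; nra.
by apply: lee_pmul; rewrite ?lee_fin.
Qed.
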